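(* Let $n\geq 2$ and $c\geq 1$ be integers, $\vec v_c=(c,c)$ and $\vartheta_c=(2c,1-2c)$. The component $\mathcal H(n,c)$ of the moduli space $\mathcal M(\Lambda_n,\vec v_c,1,\vartheta_c)$ defined by the equations $f_1=f_2=\cdots=f_{n-1}=0$ coincides with the whole of $\mathcal M(\Lambda_n,\vec v_c,1,\vartheta_c)$.
   Context: Everything is over $\mathbb C$. For $n\ge 2$, $Q_n$ is the quiver with vertices $0,1$ and a framing vertex $\infty$, and arrows $a_1,a_2\colon 0\to 1$; $c_1,\dots,c_n\colon 1\to 0$; $j\colon 0\to\infty$; $i_1,\dots,i_{n-1}\colon \infty\to 0$. Paths are composed from right to left. $J_n\subset\mathbb C Q_n$ is the two-sided ideal generated by $a_2c_{q+1}-a_1c_q$ and $c_{q+1}a_2-c_qa_1-i_qj$ for $q=1,\dots,n-1$, and $\Lambda_n=\mathbb C Q_n/J_n$. Fix vector spaces $V_0,V_1$ of dimension $c$ and $W$ of dimension $1$. The affine variety $\mathrm{Rep}(\Lambda_n,\vec v_c,1)$ of $(\vec v_c,1)$-dimensional representations of $\Lambda_n$ consists of the tuples $(A_1,A_2;C_1,\dots,C_n;e;f_1,\dots,f_{n-1})$ in $\mathrm{Hom}(V_0,V_1)^{\oplus 2}\oplus\mathrm{Hom}(V_1,V_0)^{\oplus n}\oplus\mathrm{Hom}(V_0,W)\oplus\mathrm{Hom}(W,V_0)^{\oplus n-1}$ such that $A_2C_{q+1}-A_1C_q=0$ and $C_{q+1}A_2-C_qA_1-f_qe=0$ for $q=1,\dots,n-1$.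 The group $G_{\vec v_c}=\mathrm{GL}(V_0)\times \mathrm{GL}(V_1)$ acts on it by basis change (there is no action of $\mathrm{GL}(W)$). A subrepresentation is a pair $S=(S_0,S_1)$ of subspaces $S_0\subseteq V_0$, $S_1\subseteq V_1$ with $A_i(S_0)\subseteq S_1$ for $i=1,2$ and $C_q(S_1)\subseteq S_0$ for $q=1,\dots,n$. For $\vartheta\in\mathbb R^2$, a representation is $\vartheta$-semistable if for every subrepresentation $S=(S_0,S_1)$: (i) if $S_0\subseteq\ker e$, then $\vartheta\cdot(\dim S_0,\dim S_1)\le 0$; (ii) if $S_0\supseteq\mathrm{Im}\, f_i$ for all $i=1,\dots,n-1$, then $\vartheta\cdot(\dim S_0,\dim S_1)\le\vartheta\cdot(c,c)$. It is $\vartheta$-stable if moreover the inequality in (i) is strict whenever $S\ne 0$ and that in (ii) is strict whenever $S\neq (V_0,V_1)$. $\mathrm{Rep}(\Lambda_n,\vec v_c,1)^{\mathrm{ss}}_{\vartheta_c}$ is the open subset of $\vartheta_c$-semistable representations, and $\mathcal M(\Lambda_n,\vec v_c,1,\vartheta_c)$ is the GIT quotient (in the sense of King) $\mathrm{Rep}(\Lambda_n,\vec v_c,1)^{\mathrm{ss}}_{\vartheta_c}/\!/G_{\vec v_c}$. It is known that for the parameter $\vartheta_c$ semistability and stability coincide, so that the points of the quotient are the $G_{\vec v_c}$-orbits of semistable representations. $\mathcal H(n,c)$ denotes the closed locus of $\mathcal M(\Lambda_n,\vec v_c,1,\vartheta_c)$ consisting of the orbits of semistable representations with $f_1=\cdots=f_{n-1}=0$.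 It is known (from earlier work) that $\mathcal H(n,c)$ is an irreducible component, isomorphic to the Hilbert scheme of $c$ points of the total space of the line bundle $\mathcal O_{\mathbb P^1}(-n)$. *)

(* Defs.v *)
From HB Require Import structures.
From mathcomp Require Import all_boot all_order all_algebra.
From mathcomp Require Import classical_sets reals.
From mathcomp Require Import complex.

Set Implicit Arguments.
Unset Strict Implicit.
Unset Printing Implicit Defensive.

Import GRing.Theory Num.Theory.

Local Open Scope ring_scope.
Local Open Scope complex_scope.

(* Families that the mathematics indexes from 1 are indexed from 0 here: the
   linear maps C_1, ..., C_n are indexed by 'I_n, and both f_1, ..., f_{n-1} and
   the relations by 'I_n.-1.  For q : 'I_n.-1, [idx q] and [idxS q] are the
   positions q and q + 1 in 'I_n. *)
Definition idx (n : nat) (q : 'I_n.-1) : 'I_n := widen_ord (leq_pred n) q.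

Lemma idxS_subproof (n : nat) (q : 'I_n.-1) : (q.+1 < n)%N.
Proof. by rewrite -ltn_predRL. Qed.

Definition idxS (n : nat) (q : 'I_n.-1) : 'I_n := Ordinal (idxS_subproof q).

(* The affine space
   Hom(V0,V1)^2 + Hom(V1,V0)^n + Hom(V0,W) + Hom(W,V0)^(n-1). *)
Record framedData (R : realType) (n : nat) (V0 V1 W : vectType R[i]) :=
  FramedData {
    mapA1 : 'Hom(V0, V1);
    mapA2 : 'Hom(V0, V1);
    mapC : {ffun 'I_n -> 'Hom(V1, V0)};
    mapE : 'Hom(V0, W);
    mapF : {ffun 'I_n.-1 -> 'Hom(W, V0)} }.

Section Representations.
Variables (R : realType) (n : nat) (V0 V1 W : vectType R[i]).
Implicit Types x : framedData n V0 V1 W.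

Definition is_rep x : Prop :=
  forall q : 'I_n.-1,
    (mapA2 x \o mapC x (idxS q))%VF - (mapA1 x \o mapC x (idx q))%VF = 0 /\
    (mapC x (idxS q) \o mapA2 x)%VF - (mapC x (idx q) \o mapA1 x)%VF
      - (mapF x q \o mapE x)%VF = 0.

Definition subrep x (S0 : {vspace V0}) (S1 : {vspace V1}) : Prop :=
  [/\ (mapA1 x @: S0 <= S1)%VS,
      (mapA2 x @: S0 <= S1)%VS
    & forall q : 'I_n, (mapC x q @: S1 <= S0)%VS].

Definition pairing (theta : R * R) (d0 d1 : nat) : R :=
  theta.1 * d0%:R + theta.2 * d1%:R.

Definition semistable (theta : R * R) x : Prop :=
  forall (S0 : {vspace V0}) (S1 : {vspace V1}), subrep x S0 S1 ->
    ((S0 <= lker (mapE x))%VS -> pairing theta (\dim S0) (\dim S1) <= 0) /\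
    ((forall q : 'I_n.-1, (limg (mapF x q) <= S0)%VS) ->
       pairing theta (\dim S0) (\dim S1) <=
       pairing theta (\dim {:V0}) (\dim {:V1})).

Definition repss (theta : R * R) : set (framedData n V0 V1 W) :=
  [set x | is_rep x /\ semistable theta x]%classic.

(* Injective endomorphisms of a finite-dimensional space are invertible, and
   then [(g^-1)%VF] is the two-sided inverse of g. *)
Definition GL (V : vectType R[i]) : set 'End(V) :=
  [set g | lker g = 0%VS]%classic.

Definition basis_change (g0 : 'End(V0)) (g1 : 'End(V1)) x :
    framedData n V0 V1 W :=
  FramedData
    (g1 \o mapA1 x \o g0^-1)%VF
    (g1 \o mapA2 x \o g0^-1)%VF
    [ffun q => (g0 \o mapC x q \o g1^-1)%VF]
    (mapE x \o g0^-1)%VF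
    [ffun q => (g0 \o mapF x q)%VF].

Definition Gorbit x : set (framedData n V0 V1 W) :=
  [set y | exists g0 g1, [/\ GL g0, GL g1 & y = basis_change g0 g1 x]]%classic.

(* The points of the GIT quotient of the semistable locus by GL(V0) x GL(V1)
   when semistability and stability coincide: its points are then the orbits of
   semistable representations. *)
Definition moduli (theta : R * R) : set (set (framedData n V0 V1 W)) :=
  [set Gorbit x | x in repss theta]%classic.

Definition zero_f_locus (theta : R * R) : set (set (framedData n V0 V1 W)) :=
  [set Gorbit x | x in
    [set x | repss theta x /\ forall q : 'I_n.-1, mapF x q = 0]]%classic.

End Representations.

Definition theta_c (R : realType) (c : nat) : R * R :=
  (2 * c%:R, 1 - 2 * c%:R).

(* The points of M(Lambda_n, v_c, 1, vartheta_c) and of its closed locus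
   H(n, c), for V0 and V1 of dimension c and W of dimension 1. *)
Definition Mnc (R : realType) (n c : nat) (V0 V1 W : vectType R[i]) :
    set (set (framedData n V0 V1 W)) :=
  @moduli R n V0 V1 W (theta_c R c).

Definition Hnc (R : realType) (n c : nat) (V0 V1 W : vectType R[i]) :
    set (set (framedData n V0 V1 W)) :=
  @zero_f_locus R n V0 V1 W (theta_c R c).

(* Main.v *)
(** Minimality replaces any study of the singular part of the pencil (A1, A2).
    For theta_c, semistability says that a nonzero subrepresentation inside
    ker e has dim S0 < dim S1, and that one containing all the images of the
    f_q has dim S0 <= dim S1.  Let S be a subrepresentation containing all the
    images of the f_q, with dim S0 = dim S1 = d minimal.  If d > 0, the pencil
    is singular on S for some parameter: up to the symmetry exchanging A1 with
    A2, C_q with C_(q+1) and f_q with - f_q, the map P = A1 - b A2 has a nonzero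
    kernel K in S0.  If e vanished on K, then (K, A2 K) would be a
    subrepresentation with dim K >= dim A2 K, against the first condition.
    So e does not vanish on K, and then (S0 :&: A2^-1 (P S0), P S0) is again a
    subrepresentation containing the images of the f_q.  Its first dimension is
    at least the second, hence both are equal, and they are less than d.
    Therefore d = 0, and all the f_q vanish. *)
Require Import Defs.
From mathcomp Require Import all_boot all_order all_algebra.
From mathcomp Require Import classical_sets reals.
From mathcomp Require Import complex.
From mathcomp Require Import spectral zify ring.

Import GRing.Theory Num.Theory.

Set Implicit Arguments.
Unset Strict Implicit.
Unset Printing Implicit Defensive.

Local Open Scope ring_scope.
Local Open Scope complex_scope.

(** * Linear algebra of two maps restricted to subspaces *)

Lemma img_subP (F : fieldType) (U V : vectType F) (f : 'Hom(U, V))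
    (S : {vspace U}) (T : {vspace V}) :
  reflect {in S, forall u, f u \in T} (f @: S <= T)%VS.
Proof.
apply: (iffP subvP) => [fST u uS | fST _ /memv_imgP[u uS ->]]; last exact: fST.
by rewrite fST ?memv_img.
Qed.

(** The map induced by [f] from [S / (S :&: f @^-1: T')] to [T / T'] is injective. *)
Lemma dim_cap_lpreim (F : fieldType) (U V : vectType F) (f : 'Hom(U, V))
    (S : {vspace U}) (T T' : {vspace V}) :
  (f @: S <= T)%VS -> (T' <= T)%VS ->
  (\dim S + \dim T' <= \dim (S :&: f @^-1: T') + \dim T)%N.
Proof.
move=> fST T'T.
have dS := limg_ker_dim f S.
have dM := limg_ker_dim f (S :&: f @^-1: T').
have dC := dimv_sum_cap (f @: S) T'.
have dT : (\dim (f @: S + T') <= \dim T)%N.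
  by apply: dimvS; rewrite subv_add fST.
have dK : (\dim (S :&: lker f) <= \dim (S :&: f @^-1: T' :&: lker f))%N.
  apply/dimvS/subvP=> u; rewrite !memv_cap -memv_preim => /andP[-> ku].
  by move: ku; rewrite memv_ker => /eqP->; rewrite mem0v eqxx.
have dI : (\dim (f @: S :&: T') <= \dim (f @: (S :&: f @^-1: T')))%N.
  apply/dimvS/subvP=> _ /memv_capP[/memv_imgP[u uS ->] fuT'].
  by rewrite memv_img // memv_cap uS -memv_preim.
lia.
Qed.

(** In bases of [S] and [T] both maps become square matrices; either that of [g] is singular, or the
    quotient of the two has an eigenvalue. *)
Lemma pencil_singular (K : numClosedFieldType) (U V : vectType K)
    (f g : 'Hom(U, V)) (S : {vspace U}) (T : {vspace V}) :
  (f @: S <= T)%VS -> (g @: S <= T)%VS -> (0 < \dim S)%N -> \dim S = \dim T ->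
  exists2 u, u \in S & u != 0 /\ (g u = 0 \/ exists b, f u = b *: g u).
Proof.
move=> fST gST; set d := \dim S => d_gt0 dimT.
have [X bX] : exists X : d.-tuple U, basis_of S X.
  by exists (vbasis S); apply: vbasisP.
have [Y bY] : exists Y : d.-tuple V, basis_of T Y.
  by rewrite dimT; exists (vbasis T); apply: vbasisP.
pose mx (h : 'Hom(U, V)) : 'M[K]_d := \matrix_(i, j) coord Y j (h X`_i).
pose vec (r : 'rV[K]_d) := \sum_i r 0 i *: X`_i.
have XS (i : 'I_d) : X`_i \in S by apply: (basis_mem bX); rewrite mem_nth ?size_tuple.
have vecS r : vec r \in S by apply: memv_suml => i _; rewrite memvZ.
have vec0 r : r != 0 -> vec r != 0.
  apply: contraNneq => vr0; apply/eqP/rowP=> i; rewrite mxE.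
  by have := coord_sum_free (r 0) i (basis_free bX); rewrite -/(vec r) vr0 linear0.
have vecE h r : (h @: S <= T)%VS ->
    h (vec r) = \sum_j (r *m mx h) 0 j *: Y`_j.
  move=> /img_subP hST; rewrite (coord_basis bY (hST _ (vecS r))).
  apply: eq_bigr => j _; congr (_ *: _).
  rewrite mxE /vec !linear_sum; apply: eq_bigr => i _.
  by rewrite !linearZ mxE.
have [gU | gNU] := boolP (mx g \in unitmx); last first.
  have : kermx (mx g) != 0 by rewrite kermx_eq0 row_free_unit.
  case/rowV0Pn=> r /sub_kermxP rg r0.
  exists (vec r) => //; split; [exact: vec0 | left].
  by rewrite vecE // rg big1 // => j _; rewrite mxE scale0r.
have [b /eigenvalueP[r rb r0]] := eigenvalue_closed (mx f *m invmx (mx g)) d_gt0.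
exists (vec r) => //; split; [exact: vec0 | right; exists b].
rewrite !vecE // scaler_sumr; apply: eq_bigr => j _.
rewrite scalerA; congr (_ *: _).
have -> : r *m mx f = b *: r *m mx g by rewrite -rb -!mulmxA mulVmx ?mulmx1.
by rewrite -scalemxAl mxE.
Qed.

(** * Subrepresentations cut out by a singular pencil *)

Section Pencil.
Variables (K : numClosedFieldType) (V0 V1 W : vectType K) (I : Type).
Implicit Types (A B : 'Hom(V0, V1)) (X Y : I -> 'Hom(V1, V0)).
Implicit Types (f : I -> 'Hom(W, V0)) (e : 'Hom(V0, W)).

(** Splitting the C_q into two independent families makes the exchange of the two maps of the pencil
    a formal symmetry. *)
Definition closed_pair A B X Y S0 S1 :=
  [/\ (A @: S0 <= S1)%VS, (B @: S0 <= S1)%VS,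
      forall q, (X q @: S1 <= S0)%VS & forall q, (Y q @: S1 <= S0)%VS].

(* X q, Y q and f q stand for C_q, C_(q+1) and f_q. *)
Definition pencil_relations A B X Y f e :=
  (forall q v, B (Y q v) = A (X q v)) /\
  (forall q v, Y q (B v) = X q (A v) + f q (e v)).

Lemma closed_pairC A B X Y S0 S1 :
  closed_pair A B X Y S0 S1 -> closed_pair B A Y X S0 S1.
Proof. by case. Qed.

Lemma pencil_relationsC A B X Y f e :
  pencil_relations A B X Y f e ->
  pencil_relations B A Y X (fun q => - f q) e.
Proof.
case=> BY YB; split=> [q v | q v]; first by rewrite BY.
by rewrite YB opp_lfunE addrK.
Qed.

(** On [N], where [e] vanishes and [A = b B], the relations give [Y B = X A = b X B], hence
    [A X B = B Y B = b B X B]: so [X B] preserves [N]. *)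
Lemma closed_pair_ker A B X Y f e (b : K) S0 S1 :
  pencil_relations A B X Y f e -> closed_pair A B X Y S0 S1 ->
  let N := (S0 :&: lker (A - b *: B))%VS in
  (N <= lker e)%VS -> closed_pair A B X Y N (B @: N).
Proof.
case=> BY YB [/img_subP AS /img_subP BS XS YS] N /subvP Ne.
have NP v : reflect (v \in S0 /\ A v = b *: B v) (v \in N).
  rewrite memv_cap memv_ker !lfun_simp subr_eq0.
  by apply: (iffP andP) => -[vS /eqP].
have YBN q v : v \in N -> Y q (B v) = b *: X q (B v).
  move=> vN; have /NP[_ Av] := vN; rewrite YB Av linearZ.
  by have := Ne v vN; rewrite memv_ker => /eqP->; rewrite linear0 addr0.
have XBN q v : v \in N -> X q (B v) \in N.
  move=> vN; have /NP[vS Av] := vN; apply/NP; split.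
    by move/img_subP: (XS q); apply; apply: BS.
  by rewrite -BY YBN // linearZ.
split=> [||q|q]; apply/img_subP.
- by move=> v vN; have /NP[_ ->] := vN; rewrite memvZ // memv_img.
- by move=> v vN; rewrite memv_img.
- by move=> _ /memv_imgP[v vN ->]; apply: XBN.
- by move=> _ /memv_imgP[v vN ->]; rewrite YBN // memvZ // XBN.
Qed.

Lemma closed_pair_img A B X Y f e (b : K) S0 S1 :
  pencil_relations A B X Y f e -> closed_pair A B X Y S0 S1 ->
  let T1 := ((A - b *: B) @: S0)%VS in
  let T0 := (S0 :&: B @^-1: T1)%VS in
  (forall q, (limg (f q) <= T0)%VS) -> closed_pair A B X Y T0 T1.
Proof.
case=> BY YB [/img_subP AS /img_subP BS XS YS] T1 T0 fT.
have T1P v : v \in S0 -> A v - b *: B v \in T1.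
  by move=> vS; have := memv_img (A - b *: B)%VF vS; rewrite !lfun_simp.
have T0P v : reflect (v \in S0 /\ B v \in T1) (v \in T0).
  by rewrite memv_cap -memv_preim; apply: andP.
have XS' q v : v \in S1 -> X q v \in S0 by move/img_subP: (XS q); apply.
have YS' q v : v \in S1 -> Y q v \in S0 by move/img_subP: (YS q); apply.
have AT v : v \in T0 -> A v \in T1.
  by case/T0P=> vS BvT; rewrite -(subrK (b *: B v) (A v)) rpredD ?T1P ?rpredZ.
have T1S v : v \in T1 -> v \in S1.
  case/memv_imgP=> u uS ->; rewrite !lfun_simp.
  by rewrite rpredB ?AS // rpredZ ?BS.
(* With [P = A - b B], the relations give [B X P u = P (X B u) - B (f (e u))], and both terms lie in
   [T1]. *)
have XT q v : v \in T1 -> X q v \in T0.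
  move=> vT; apply/T0P; split; first by rewrite XS' ?T1S.
  case/memv_imgP: vT => u uS ->; rewrite !lfun_simp linearB linearZ /=.
  have -> : X q (A u) = Y q (B u) - f q (e u) by rewrite YB addrK.
  rewrite addrAC linearB /= rpredB //; last first.
    by have /T0P[] : f q (e u) \in T0 by move/img_subP: (fT q); apply; apply: memvf.
  by rewrite linearB linearZ /= BY T1P // XS' // BS.
split=> [||q|q]; apply/img_subP.
- exact: AT.
- by move=> v /T0P[].
- exact: XT.
- move=> v vT; apply/T0P; split; first by rewrite YS' ?T1S.
  by rewrite BY AT // XT.
Qed.

(** The line [W] is spanned by [e v], and [f q (e v) = Y q (B v) - X q (A v)] is sent by [B] to
    [(A - b B) (X q (B v))]. *)
Lemma limg_framing_pencil A B X Y f e (b : K) S0 S1 v :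
  pencil_relations A B X Y f e -> closed_pair A B X Y S0 S1 ->
  \dim {:W} = 1%N -> v \in S0 -> A v = b *: B v -> e v != 0 ->
  forall q, (limg (f q) <= S0 :&: B @^-1: ((A - b *: B) @: S0))%VS.
Proof.
case=> BY YB [/img_subP AS /img_subP BS XS YS] dimW vS Av ev q.
have -> : fullv = <[e v]>%VS.
  by apply/eqP; rewrite eq_sym eqEdim subvf dimW dim_vline ev.
rewrite limg_line -memvE.
have vB : B v \in S1 by apply: BS.
have -> : f q (e v) = Y q (B v) - X q (A v) by rewrite YB addrC addKr.
rewrite memv_cap -memv_preim; apply/andP; split.
  by apply: rpredB; [move/img_subP: (YS q) | move/img_subP: (XS q)];
    apply=> //; apply: AS.
have -> : B (Y q (B v) - X q (A v)) = (A - b *: B)%VF (X q (B v)).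
  by rewrite !lfun_simp linearB /= BY Av linearZ linearZ.
by apply: memv_img; move/img_subP: (XS q); apply.
Qed.

(** This and [img_bound] are the dimension inequalities that the two semistability conditions yield
    for [theta_c]. *)
Definition ker_bound A B X Y e := forall N0 N1,
  closed_pair A B X Y N0 N1 -> (N0 <= lker e)%VS ->
  (\dim N1 <= \dim N0)%N -> \dim N0 = 0%N.

Definition img_bound A B X Y f := forall N0 N1,
  closed_pair A B X Y N0 N1 -> (forall q, (limg (f q) <= N0)%VS) ->
  (\dim N0 <= \dim N1)%N.

Definition balanced_pair A B X Y f S0 S1 :=
  [/\ closed_pair A B X Y S0 S1, forall q, (limg (f q) <= S0)%VS
    & \dim S0 = \dim S1].

Lemma balanced_pair_descent_eigen A B X Y f e (b : K) S0 S1 v :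
  \dim {:W} = 1%N -> pencil_relations A B X Y f e ->
  ker_bound A B X Y e -> img_bound A B X Y f -> balanced_pair A B X Y f S0 S1 ->
  v \in S0 -> v != 0 -> A v = b *: B v ->
  exists T0 T1, balanced_pair A B X Y f T0 T1 /\ (\dim T0 < \dim S0)%N.
Proof.
move=> dimW rel kerB imgB [clS fS dimS] vS v0 Av.
set P := (A - b *: B)%VF; set N := (S0 :&: lker P)%VS.
have vN : v \in N by rewrite memv_cap vS memv_ker !lfun_simp Av subrr eqxx.
have N_gt0 : (0 < \dim N)%N.
  by rewrite lt0n dimv_eq0 -subv0; apply/subvPn; exists v; rewrite // memv0.
have [u uN eu] : exists2 u, u \in N & e u != 0.
  have /subvPn[u uN eu] : ~~ (N <= lker e)%VS.
    apply: contraL N_gt0 => Ne; rewrite -leqNgt.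
    rewrite (kerB N (B @: N)%VS) //; first exact: closed_pair_ker rel clS Ne.
    by rewrite -(limg_ker_dim B N) leq_addl.
  by exists u; rewrite -?memv_ker.
have [uS Au] : u \in S0 /\ A u = b *: B u.
  move: uN; rewrite memv_cap memv_ker !lfun_simp subr_eq0.
  by case/andP=> uS /eqP.
have fT := limg_framing_pencil rel clS dimW uS Au eu.
have clT := closed_pair_img rel clS fT.
have le_dimT := imgB _ _ clT fT.
case: (clS) => AS BS _ _.
have PS : (P @: S0 <= S1)%VS.
  apply/img_subP=> w wS; rewrite !lfun_simp.
  by rewrite rpredB ?rpredZ //; [move/img_subP: AS | move/img_subP: BS]; apply.
(* As [S0] and [S1] have equal dimension, this is the inequality opposite to [le_dimT]; the drop in
   dimension comes from [N] being nonzero. *)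
have ge_dimT := dim_cap_lpreim BS PS.
have dimP := limg_ker_dim P S0; rewrite -/N in dimP.
exists (S0 :&: B @^-1: (P @: S0))%VS, (P @: S0)%VS.
rewrite -/P in clT fT le_dimT.
split; last by lia.
by split=> //; lia.
Qed.

Lemma balanced_pair_descent A B X Y f e S0 S1 :
  \dim {:W} = 1%N -> pencil_relations A B X Y f e ->
  ker_bound A B X Y e -> img_bound A B X Y f -> balanced_pair A B X Y f S0 S1 ->
  (0 < \dim S0)%N ->
  exists T0 T1, balanced_pair A B X Y f T0 T1 /\ (\dim T0 < \dim S0)%N.
Proof.
move=> dimW rel kerB imgB balS S_gt0; case: (balS) => clS fS dimS.
case: (clS) => AS BS _ _.
have [v vS [v0 [Bv | [b Av]]]] := pencil_singular AS BS S_gt0 dimS; last first.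
  exact: balanced_pair_descent_eigen dimW rel kerB imgB balS vS v0 Av.
have limgN (g : 'Hom(W, V0)) T : (limg (- g) <= T)%VS = (limg g <= T)%VS.
  by apply/img_subP/img_subP=> gT w /gT; rewrite opp_lfunE rpredN.
have kerB' : ker_bound B A Y X e.
  by move=> N0 N1 /closed_pairC; apply: kerB.
have imgB' : img_bound B A Y X (fun q => - f q).
  move=> N0 N1 /closed_pairC clN fN; apply: (imgB _ _ clN) => q.
  by rewrite -limgN.
have balS' : balanced_pair B A Y X (fun q => - f q) S0 S1.
  by split=> // [|q]; [apply: closed_pairC | rewrite limgN].
(* A kernel vector of [B] is an eigenvector of the exchanged pencil, with parameter 0. *)
have Bv' : B v = 0 *: A v by rewrite scale0r.
have [T0 [T1 [[clT fT dimT] ltT]]] := balanced_pair_descent_eigen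
  dimW (pencil_relationsC rel) kerB' imgB' balS' vS v0 Bv'.
exists T0, T1; split=> //; split=> // [|q]; first exact: closed_pairC.
by rewrite -limgN.
Qed.

Lemma framing_eq0 A B X Y f e S0 S1 :
  \dim {:W} = 1%N -> pencil_relations A B X Y f e ->
  ker_bound A B X Y e -> img_bound A B X Y f -> balanced_pair A B X Y f S0 S1 ->
  forall q, f q = 0.
Proof.
move=> dimW rel kerB imgB.
have [d] := ubnP (\dim S0); elim: d S0 S1 => // d IHd S0 S1 leSd balS q.
have [S_gt0 | ] := ltnP 0 (\dim S0).
  have [T0 [T1 [balT ltT]]] := balanced_pair_descent dimW rel kerB imgB balS S_gt0.
  by apply: IHd balT q; lia.
rewrite leqn0 dimv_eq0 => /eqP S0_eq0; case: balS => _ /(_ q).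
rewrite S0_eq0 => /subvP f0 _; apply/lfunP=> w.
by have := f0 _ (memv_img (f q) (memvf w)); rewrite memv0 lfunE => /eqP.
Qed.

End Pencil.

(** * Numerical content of the stability parameter *)

Lemma pairing_theta_c (R : realType) (c d0 d1 : nat) :
  pairing (theta_c R c) d0 d1 = (2 * c * d0 + d1)%:R - (2 * c * d1)%:R.
Proof.
rewrite /pairing /theta_c /= !natrD !natrM; ring.
Qed.

(** The pairing is [2c (d0 - d1) + d1], a sum of two nonnegative terms when [d1 <= d0]. *)
Lemma pairing_theta_c_le0 (R : realType) (c d0 d1 : nat) :
  (0 < c)%N -> (d1 <= d0)%N -> pairing (theta_c R c) d0 d1 <= 0 -> d0 = 0%N.
Proof. by move=> c_gt0 le_d; rewrite pairing_theta_c subr_le0 ler_nat; nia. Qed.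

(** The right side equals [c], while [d0 > d1] would make the left side at least [2c]. *)
Lemma pairing_theta_c_le (R : realType) (c d0 d1 : nat) :
  (0 < c)%N ->
  pairing (theta_c R c) d0 d1 <= pairing (theta_c R c) c c -> (d0 <= d1)%N.
Proof.
move=> c_gt0; rewrite !pairing_theta_c lerBlDr addrAC lerBrDr -!natrD ler_nat.
nia.
Qed.

Lemma repss_framing_eq0 (R : realType) (n c : nat) (V0 V1 W : vectType R[i])
    (x : framedData n V0 V1 W) :
  (1 < n)%N -> (0 < c)%N -> \dim {:V0} = c -> \dim {:V1} = c ->
  \dim {:W} = 1%N ->
  repss (theta_c R c) x -> forall q : 'I_n.-1, mapF x q = 0.
Proof.
move=> n_gt1 c_gt0 dimV0 dimV1 dimW [rel_x ss_x].
pose X q := mapC x (idx q); pose Y q := mapC x (idxS q).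
have rel : pencil_relations (mapA1 x) (mapA2 x) X Y (mapF x) (mapE x).
  split=> q v; have [/lfunP relA /lfunP relC] := rel_x q.
    by move/(_ v): relA; rewrite !lfun_simp => /eqP; rewrite subr_eq0 => /eqP.
  move/(_ v): relC; rewrite !lfun_simp => /eqP.
  by rewrite -addrA -opprD subr_eq0 => /eqP.
have sub N0 N1 : closed_pair (mapA1 x) (mapA2 x) X Y N0 N1 -> subrep x N0 N1.
  case=> A1N A2N XN YN; split=> // q.
  (* Only the last C is missing from [X]; it is the last member of [Y], which exists because [n] is
     at least 2. *)
  have [qn | ] := ltnP q n.-1.
    by have := XN (Ordinal qn); congr (mapC x _ @: _ <= _)%VS; apply: val_inj.
  move=> qn; have qn' : (q.-1 < n.-1)%N by have := ltn_ord q; lia.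
  have := YN (Ordinal qn'); congr (mapC x _ @: _ <= _)%VS; apply: val_inj => /=.
  by lia.
(* The descent starts from the whole representation, balanced since both dimensions are [c]. *)
apply: (@framing_eq0 _ _ _ _ _ _ _ _ _ _ _ fullv fullv dimW rel).
- move=> N0 N1 /sub/ss_x[+ _] eN le_dim => /(_ eN).
  exact: pairing_theta_c_le0.
- move=> N0 N1 /sub/ss_x[_ +] fN => /(_ fN); rewrite dimV0 dimV1.
  exact: pairing_theta_c_le.
- split; last by rewrite dimV0 dimV1.
    by split=> *; apply: subvf.
  by move=> q; apply: subvf.
Qed.

Theorem theorem3p8 (R : realType) (n c : nat) (V0 V1 W : vectType R[i])
    (hn : (2 <= n)%N) (hc : (1 <= c)%N)
    (hV0 : \dim {:V0} = c) (hV1 : \dim {:V1} = c) (hW : \dim {:W} = 1%N) :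
  @Hnc R n c V0 V1 W = @Mnc R n c V0 V1 W.
Proof.
apply/seteqP; split=> _ [x xss <-]; first by exists x => //; case: xss.
exists x => //; split=> //.
exact: repss_framing_eq0 hn hc hV0 hV1 hW xss.
Qed.
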